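(* Let $S_1,S_2\subset\mathbb{R}^3$ be two real rational ruled surfaces properly parametrized by $\boldsymbol{x}_i(t,s)=\boldsymbol{p}_i(t)+s\,\boldsymbol{q}_i(t)$, $i=1,2$. Let $f:\mathbb{R}^3\to\mathbb{R}^3$, $f(\mathbf{x})=\boldsymbol{A}\mathbf{x}+\boldsymbol{b}$, with $\boldsymbol{A}\in\mathbb{R}^{3\times 3}$ nonsingular and $\boldsymbol{b}\in\mathbb{R}^3$. Then $f(S_1)=S_2$ (so that $S_1,S_2$ are affinely equivalent) if and only if there exists a birational transformation $\varphi:\mathbb{R}^2\dashrightarrow\mathbb{R}^2$ such that $$f\circ\boldsymbol{x}_1=\boldsymbol{x}_2\circ\varphi,$$ i.e. such that $f(\boldsymbol{x}_1(t,s))=\boldsymbol{x}_2(\varphi(t,s))$ for a generic point $(t,s)\in\mathbb{R}^2$.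
   Context: Here $\boldsymbol{p}_i,\boldsymbol{q}_i$ are triples of real rational functions of $t$, and $S_i$ is the (irreducible, two-dimensional) real algebraic surface parametrized by $\boldsymbol{x}_i$, i.e. the Zariski closure in $\mathbb{R}^3$ of the image of $\boldsymbol{x}_i$. The parametrization $\boldsymbol{x}_i$ is proper if it is birational as a map $\mathbb{R}^2\dashrightarrow S_i$; that is, $\boldsymbol{x}_i^{-1}$ exists as a rational map. ''Generic'' means outside a proper Zariski-closed subset of $\mathbb{R}^2$. Two surfaces $S_1,S_2$ are affinely equivalent if there is a nonsingular affine map $f$ with $f(S_1)=S_2$. *)

(* Defs.v *)
From mathcomp Require Import all_boot all_order all_algebra.
From mathcomp Require Import classical_sets reals.
From mathcomp Require Import mpoly.

Set Implicit Arguments.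
Unset Strict Implicit.
Unset Printing Implicit Defensive.

Import GRing.Theory.
Local Open Scope ring_scope.
Local Open Scope classical_set_scope.

(* A partial map from T to U is represented by its graph [G : T -> U -> Prop];
   "[G x y]" reads "[G] is defined at [x], with value [y]". *)
Definition part_comp (T U V : Type) (H : U -> V -> Prop) (G : T -> U -> Prop)
  : T -> V -> Prop := fun x z => exists2 y, G x y & H y z.

Definition part_fun (T U : Type) (f : T -> U) : T -> U -> Prop :=
  fun x y => y = f x.

Section Geometry.
Variable R : realType.

Definition peval n (g : {mpoly R[n]}) (x : 'cV[R]_n) : R :=
  g.@[fun i => x i 0].

Definition zariski_closed n (Z : set 'cV[R]_n) : Prop :=
  exists I : set {mpoly R[n]},
    Z = [set x | forall g, I g -> peval g x = 0].

Definition zariski_closure n (A : set 'cV[R]_n) : set 'cV[R]_n :=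
  smallest (@zariski_closed n) A.

(* [P] holds at the generic point of [X], i.e. on [X] outside a Zariski-closed
   subset that does not contain [X]. Only used with [X] irreducible. *)
Definition generic_on n (X : set 'cV[R]_n) (P : 'cV[R]_n -> Prop) : Prop :=
  exists Z : set 'cV[R]_n,
    [/\ zariski_closed Z, ~ X `<=` Z & forall x, X x -> ~ Z x -> P x].

Definition generic_eq n (T : Type) (X : set 'cV[R]_n)
    (F G : 'cV[R]_n -> T -> Prop) : Prop :=
  generic_on X (fun x => exists2 y, F x y & G x y).

(* Value of an element [f] of a field of fractions under the partial extension
   of the evaluation [ev : P -> R]: [f] is defined as soon as one of its
   representations [n / d] has [ev d != 0], and the value [v] does not depend
   on that representation when [ev] is a ring morphism. *)
Definition frac_val (P : idomainType) (ev : P -> R)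
    (f : {fraction P}) (v : R) : Prop :=
  exists n d : P,
    [/\ ev d != 0, f = tofrac n / tofrac d & v = ev n / ev d].

Definition curve_val m (p : 'cV[{fraction {poly R}}]_m) (t : R)
    (y : 'cV[R]_m) : Prop :=
  forall i, frac_val (fun g : {poly R} => g.[t]) (p i 0) (y i 0).

Definition ratmap n m (phi : 'cV[{fraction {mpoly R[n]}}]_m)
    (x : 'cV[R]_n) (y : 'cV[R]_m) : Prop :=
  forall i, frac_val (fun g : {mpoly R[n]} => peval g x) (phi i 0) (y i 0).

(* [G] is birational from R^n to the irreducible variety [Y] of R^m: it maps
   into [Y] and has a rational inverse [Y --> R^n]. A rational map on [Y] is
   given by rational functions of the ambient coordinates; the second
   [generic_eq] forces them to be defined at a generic point of [Y]. *)
Definition birational_onto n m (Y : set 'cV[R]_m)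
    (G : 'cV[R]_n -> 'cV[R]_m -> Prop) : Prop :=
  (forall x y, G x y -> Y y) /\
  exists psi : 'cV[{fraction {mpoly R[m]}}]_n,
    generic_eq setT (part_comp (ratmap psi) G) (part_fun id) /\
    generic_eq Y (part_comp G (ratmap psi)) (part_fun id).

Definition birational_transformation n (phi : 'cV[{fraction {mpoly R[n]}}]_n)
  : Prop := birational_onto setT (ratmap phi).

(* (t, s) |-> p(t) + s q(t), where t and s are the coordinates of [u]. *)
Definition ruled_param (p q : 'cV[{fraction {poly R}}]_3)
    (u : 'cV[R]_2) (x : 'cV[R]_3) : Prop :=
  exists a b : 'cV[R]_3,
    [/\ curve_val p (u 0 0) a, curve_val q (u 0 0) b & x = a + u 1 0 *: b].

Definition ruled_surface (p q : 'cV[{fraction {poly R}}]_3) : set 'cV[R]_3 :=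
  zariski_closure [set x | exists u, ruled_param p q u x].

Definition proper_param (p q : 'cV[{fraction {poly R}}]_3) : Prop :=
  birational_onto (ruled_surface p q) (ruled_param p q).

Definition affine_map (A : 'M[R]_3) (b x : 'cV[R]_3) : 'cV[R]_3 :=
  A *m x + b.

End Geometry.

(* Main.v *)
(* Let psi1, psi2 be the rational inverses of x1, x2. If f(S1) = S2, then
   phi = psi2 o f o x1 satisfies f o x1 = x2 o phi, and psi1 o f^-1 o x2 is its
   rational inverse; these composites make sense because a denominator of psi2
   that is nonzero at one point of f(S1) is nonzero at the image of the generic
   parameter. Conversely, if f o x1 = x2 o phi generically, a polynomial that
   vanishes on S2 pulls back along f o x1 to a rational function that vanishes
   generically, hence wherever it is defined; so f(S1) is contained in S2, and
   composing with the inverse of phi gives the other inclusion. *)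
Require Import Defs.
From mathcomp Require Import all_boot all_order all_algebra.
From mathcomp Require Import boolp classical_sets reals.
From mathcomp Require Import mpoly.
Local Open Scope ring_scope.
Local Open Scope classical_set_scope.

Set Implicit Arguments.
Unset Strict Implicit.
Unset Printing Implicit Defensive.
Import GRing.Theory Num.Theory.

(** * Partial evaluation of fractions *)

Section FracVal.
Variables (P : idomainType) (R : realType) (ev : {rmorphism P -> R}).
Implicit Types (f g : {fraction P}) (v w : R).

Lemma tofrac_div_eq (n d n' d' : P) : d != 0 -> d' != 0 ->
  (tofrac n / tofrac d = tofrac n' / tofrac d') <-> (n * d' = n' * d).
Proof.
move=> d0 d'0; split=> [/eqP|e].
  by rewrite eqr_div ?tofrac_eq0// -!tofracM tofrac_eq => /eqP.
by apply/eqP; rewrite eqr_div ?tofrac_eq0// -!tofracM e.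
Qed.

Lemma rmorph_neq0 (d : P) : ev d != 0 -> d != 0.
Proof. by apply: contraNneq => ->; rewrite rmorph0. Qed.

(** Equal fractions have equal cross products, and [ev], being a ring morphism, carries that
    identity to the values. *)
Lemma frac_val_fun f v w : frac_val ev f v -> frac_val ev f w -> v = w.
Proof.
move=> [n [d [d0 -> ->]]] [n' [d' [d'0 e ->]]].
move/tofrac_div_eq: e => /(_ (rmorph_neq0 d0) (rmorph_neq0 d'0)) e.
by apply/eqP; rewrite eqr_div// -!rmorphM e.
Qed.

Lemma frac_val_tofrac (n : P) : frac_val ev (tofrac n) (ev n).
Proof. by exists n, 1; rewrite rmorph1 oner_neq0 tofrac1 !divr1. Qed.

Lemma frac_valD f g v w :
  frac_val ev f v -> frac_val ev g w -> frac_val ev (f + g) (v + w).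
Proof.
move=> [n [d [d0 -> ->]]] [n' [d' [d'0 -> ->]]].
have [d1 d'1] := (rmorph_neq0 d0, rmorph_neq0 d'0).
exists (n * d' + n' * d), (d * d'); rewrite rmorphM mulf_neq0//; split=> //.
  by rewrite addf_div ?tofrac_eq0// tofracD !tofracM.
by rewrite addf_div// rmorphD !rmorphM.
Qed.

Lemma frac_valM f g v w :
  frac_val ev f v -> frac_val ev g w -> frac_val ev (f * g) (v * w).
Proof.
move=> [n [d [d0 -> ->]]] [n' [d' [d'0 -> ->]]].
exists (n * n'), (d * d'); rewrite rmorphM mulf_neq0//; split=> //.
  by rewrite mulf_div !tofracM.
by rewrite mulf_div rmorphM.
Qed.

Lemma frac_valV f v : v != 0 -> frac_val ev f v -> frac_val ev f^-1 v^-1.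
Proof.
move=> v0 [n [d [d0 -> e]]]; exists d, n; rewrite e !invf_div; split=> //.
by apply: contraNneq v0 => n0; rewrite e n0 mul0r.
Qed.

End FracVal.

Lemma rmorph_mmap n (R S T : nzRingType) (phi : {rmorphism S -> T})
    (c : {rmorphism R -> S}) (h : 'I_n -> S) (p : {mpoly R[n]}) :
  phi (mmap c h p) = mmap (phi \o c) (phi \o h) p.
Proof.
rewrite /mmap rmorph_sum; apply: eq_bigr => m _.
rewrite rmorphM rmorph_prod; congr (_ * _).
by apply: eq_bigr => i _; rewrite rmorphXn.
Qed.

Lemma poly_nonroot (R : realType) (p : {poly R}) : p != 0 -> exists x, p.[x] != 0.
Proof.
move=> p0; apply: contrapT => /forallNP h.
(* In characteristic zero the naturals below [size p] are distinct, hence too many to be all roots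
   of [p]. *)
have : (size [seq i%:R : R | i <- iota 0 (size p)] < size p)%N.
  apply: max_poly_roots => //.
    by apply/allP => x _; apply/rootP/eqP/negPn/negP/h.
  rewrite map_inj_uniq ?iota_uniq// => i j /eqP.
  by rewrite eqr_nat => /eqP.
by rewrite size_map size_iota ltnn.
Qed.

(** * Evaluation of polynomials and generic points *)

Section Evaluation.
Variable R : realType.

(* [peval^~ x] as a ring morphism, in a form convertible to [peval]. *)
Definition evx n (x : 'cV[R]_n) : {rmorphism {mpoly R[n]} -> R} :=
  meval (fun i => x i 0).

Lemma pevalM n (g h : {mpoly R[n]}) x :
  peval (g * h) x = peval g x * peval h x.
Proof. exact: (rmorphM (evx x)). Qed.

Lemma peval_prod n (I : finType) (g : I -> {mpoly R[n]}) x :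
  peval (\prod_i g i) x = \prod_i peval (g i) x.
Proof. exact: (rmorph_prod (evx x)). Qed.

Lemma peval_mmap m n (h : 'I_n -> {mpoly R[m]}) (g : {mpoly R[n]})
    (u : 'cV[R]_m) (x : 'cV[R]_n) : (forall i, peval (h i) u = x i 0) ->
  peval (mmap (@mpolyC m R) h g) u = peval g x.
Proof.
move=> hx; rewrite -[LHS]/(evx u _) rmorph_mmap /peval /mmap.
apply: eq_bigr => k _ /=; rewrite mevalC; congr (_ * _).
by apply: eq_bigr => i _ /=; rewrite -hx.
Qed.

Lemma peval_line n (g : {mpoly R[n]}) (x y : 'cV[R]_n) :
  exists l : {poly R}, forall t, l.[t] = peval g (x + t *: (y - x)).
Proof.
exists (mmap (@polyC R) (fun i => (x i 0)%:P + 'X * ((y - x) i 0)%:P) g) => t.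
rewrite -[LHS]/(horner_eval t _) rmorph_mmap /peval /meval /mmap.
apply: eq_bigr => k _ /=; rewrite horner_evalE hornerC; congr (_ * _).
by apply: eq_bigr => i _; rewrite /= horner_evalE !hornerE !mxE.
Qed.

(* Real affine space is irreducible: restrict both polynomials to the line
   through the two points. *)
Lemma peval_neq0M n (g h : {mpoly R[n]}) (x y : 'cV[R]_n) :
  peval g x != 0 -> peval h y != 0 -> exists z, peval (g * h) z != 0.
Proof.
have [[l lE] [k kE]] := (peval_line g x y, peval_line h x y).
move=> gx hy.
have l0 : l != 0.
  by apply: contraNneq gx => l0; have := lE 0; rewrite l0 horner0 scale0r addr0 => <-.
have k0 : k != 0.
  apply: contraNneq hy => k0; have := kE 1.
  by rewrite k0 horner0 scale1r addrC subrK => <-.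
have [t] := poly_nonroot (mulf_neq0 l0 k0).
by rewrite hornerM lE kE -pevalM; exists (x + t *: (y - x)).
Qed.

(** The zero set of a single [g] vanishing on [A] is one of the closed sets that the closure is
    contained in. *)
Lemma zariski_closureP n (A : set 'cV[R]_n) x :
  zariski_closure A x <->
  (forall g, (forall y, A y -> peval g y = 0) -> peval g x = 0).
Proof.
split=> [Ax g gA|h B [[I ->] AB] g Ig].
  by apply: (Ax [set y | forall k, k = g -> peval k y = 0]);
    [split=> [|y /gA gy k ->//]; exists [set g] | ].
by apply: h => y /AB; apply.
Qed.

(** If [X] is not contained in a closed set, one of its equations [g] is nonzero somewhere on [X];
    the locus where [g] is nonzero then avoids the closed set. *)
Lemma generic_onP n (X : set 'cV[R]_n) (P : 'cV[R]_n -> Prop) :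
  generic_on X P <-> exists g x, [/\ X x, peval g x != 0 &
    forall y, X y -> peval g y != 0 -> P y].
Proof.
split=> [[Z [[I ->] /existsNP[x /not_implyP[Xx /existsNP[g /not_implyP[Ig gx]]]] h]]
        |[g [x [Xx gx h]]]].
  exists g, x; split=> //; first exact/eqP.
  by move=> y Xy gy; apply: h => // /(_ g Ig)/eqP; apply/negP.
exists [set y | forall k, k = g -> peval k y = 0]; split.
- by exists [set g].
- by move=> /(_ x Xx g erefl)/eqP; apply/negP.
- by move=> y Xy Zy; apply: h => //; apply/eqP => gy; apply: Zy => k ->.
Qed.

Lemma generic_on_ex n (X : set 'cV[R]_n) P : generic_on X P ->
  exists2 x, X x & P x.
Proof. by move=> /generic_onP[g [x [Xx gx h]]]; exists x => //; apply: h. Qed.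

Lemma generic_onW n (X : set 'cV[R]_n) (P Q : 'cV[R]_n -> Prop) :
  (forall x, P x -> Q x) -> generic_on X P -> generic_on X Q.
Proof. by move=> PQ [Z [Zc XZ h]]; exists Z; split=> // x Xx Zx; apply/PQ/h. Qed.

Lemma generic_onTI n (P Q : 'cV[R]_n -> Prop) :
  generic_on setT P -> generic_on setT Q ->
  generic_on setT (fun x => P x /\ Q x).
Proof.
move=> /generic_onP[g [x [_ gx hP]]] /generic_onP[h [y [_ hy hQ]]].
have [z ghz] := peval_neq0M gx hy; apply/generic_onP; exists (g * h), z.
split=> // u _; rewrite pevalM mulf_eq0 negb_or => /andP[gu hu].
by split; [exact: hP|exact: hQ].
Qed.

Lemma affine_pullback (A : 'M[R]_3) (b : 'cV[R]_3) (g : {mpoly R[3]}) :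
  exists h : {mpoly R[3]}, forall x, peval h x = peval g (affine_map A b x).
Proof.
exists (mmap (@mpolyC 3 R) (fun i => \sum_j (A i j)%:MP * 'X_j + (b i 0)%:MP) g).
move=> x; apply: peval_mmap => i.
rewrite -[LHS]/(evx x _) rmorphD rmorph_sum /= mevalC !mxE; congr (_ + _).
by apply: eq_bigr => j _; rewrite mevalM mevalC mevalXU.
Qed.

(** * Composition of polynomials with rational maps *)

Lemma ratmap_fun m n (X : 'cV[{fraction {mpoly R[m]}}]_n) u x y :
  ratmap X u x -> ratmap X u y -> x = y.
Proof.
move=> Xx Xy; apply/colP => i.
exact: (@frac_val_fun _ _ (evx u) _ _ _ (Xx i) (Xy i)).
Qed.

(** [F] is [g] with the components of [X] substituted for the variables; [frac_val] is compatible
    with constants, sums and products. *)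
Lemma ratmap_peval m n (X : 'cV[{fraction {mpoly R[m]}}]_n)
    (g : {mpoly R[n]}) :
  exists F : {fraction {mpoly R[m]}}, forall u x, ratmap X u x ->
    frac_val (fun k : {mpoly R[m]} => peval k u) F (peval g x).
Proof.
pose c : {rmorphism R -> {fraction {mpoly R[m]}}} :=
  @FracField.tofrac {mpoly R[m]} \o @mpolyC m R.
exists (mmap c (fun i => X i 0) g) => u x Xx.
have cst (k : R) : frac_val (evx u) (c k) k.
  by have := frac_val_tofrac (evx u) k%:MP; rewrite /= mevalC.
have one : frac_val (evx u) 1 1 by have := cst 1; rewrite rmorph1.
change (frac_val (evx u) (mmap c (fun i => X i 0) g) (peval g x)).
rewrite /peval /meval /mmap.
apply: (big_ind2 (frac_val (evx u))) => [|F v G w|k _].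
- by have := cst 0; rewrite rmorph0.
- exact: frac_valD.
apply: frac_valM => //.
apply: (big_ind2 (frac_val (evx u))) => [//|F v G w|i _].
  exact: frac_valM.
elim: (k i) => [|e IH]; rewrite ?expr0// !exprS.
by apply: frac_valM => //; apply: Xx.
Qed.

Lemma ratmap_generic m n (X : 'cV[{fraction {mpoly R[m]}}]_n)
    (g : {mpoly R[n]}) u0 x0 : ratmap X u0 x0 -> peval g x0 != 0 ->
  generic_on setT (fun u => exists2 x, ratmap X u x & peval g x != 0).
Proof.
move=> Xx0 gx0; have [F FE] := ratmap_peval X g.
have [n0 [d0 [d0u Fnd gE]]] := FE _ _ Xx0.
have /fin_all_exists[N /fin_all_exists[D XE]] := Xx0.
(* The factor [n0] keeps the value of [g] nonzero, [d0] keeps the representation of [F] valid, and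
   the [D i] keep [X] defined. *)
apply/generic_onP; exists (n0 * d0 * \prod_i D i), u0; split=> //.
  rewrite !pevalM peval_prod !mulf_neq0//.
    by apply: contraNneq gx0 => n00; rewrite gE n00 mul0r.
  by apply/prodf_neq0 => i _; have [] := XE i.
move=> u _; rewrite !pevalM peval_prod !mulf_eq0 !negb_or.
move=> /andP[/andP[n0u d0u1] /prodf_neq0 Du].
pose x := \col_i (peval (N i) u / peval (D i) u).
have Xx : ratmap X u x.
  by move=> i; exists (N i), (D i); rewrite mxE; have [_ e _] := XE i; split=> //; apply: Du.
exists x => //.
rewrite (@frac_val_fun _ _ (evx u) _ _ (peval n0 u / peval d0 u) (FE _ _ Xx)).
  by rewrite mulf_neq0// invr_eq0.
by exists n0, d0.
Qed.

(** * Ruled parametrizations as rational maps of the plane *)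

Lemma poly_embed : exists T : {rmorphism {poly R} -> {mpoly R[2]}},
  forall g (u : 'cV[R]_2), peval (T g) u = g.[u 0 0].
Proof.
exists (horner_eval ('X_0 : {mpoly R[2]}) \o map_poly (@mpolyC 2 R)) => g u.
rewrite -[LHS]/(evx u _) /= horner_evalE -horner_map /= mevalXU.
rewrite -map_poly_comp map_poly_id// => c _ /=; exact: mevalC.
Qed.

Lemma fraction_poly_embed (f : {fraction {poly R}}) :
  exists F : {fraction {mpoly R[2]}}, forall (u : 'cV[R]_2) v,
    frac_val (fun g : {poly R} => g.[u 0 0]) f v ->
    frac_val (fun g : {mpoly R[2]} => peval g u) F v.
Proof.
have [T TE] := poly_embed.
(* If [f] is defined nowhere, any [F] will do. *)
have [[t [v0 [n [d [d0 fE _]]]]]|nof] :=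
  pselect (exists t v, frac_val (fun g : {poly R} => g.[t]) f v); last first.
  by exists 0 => u v fv; case: nof; exists (u 0 0), v.
exists (tofrac (T n) / tofrac (T d)) => u v [n' [d' [d'0 fE' ->]]].
have d1 := @rmorph_neq0 _ _ (horner_eval t) _ d0.
have d'1 := @rmorph_neq0 _ _ (horner_eval (u 0 0)) _ d'0.
exists (T n'), (T d'); rewrite !TE; split=> //.
(* A nonzero value of [e] at [w] is also a value of [T e], at a point with first coordinate [w]. *)
have Tneq0 w e : e.[w] != 0 -> T e != 0.
  move=> ew; apply: (@rmorph_neq0 _ _ (evx (const_mx w : 'cV[R]_2))).
  by rewrite -[evx _ _]/(peval _ _) TE mxE.
apply/tofrac_div_eq; [exact: Tneq0 d0|exact: Tneq0 d'0|].
by rewrite -!rmorphM; congr (T _); apply/tofrac_div_eq; rewrite // -fE -fE'.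
Qed.

Lemma ruled_ratmap (p q : 'cV[{fraction {poly R}}]_3) :
  exists X : 'cV[{fraction {mpoly R[2]}}]_3,
    forall u x, ruled_param p q u x -> ratmap X u x.
Proof.
have /fin_all_exists[a aE] := fun i => fraction_poly_embed (p i 0).
have /fin_all_exists[b bE] := fun i => fraction_poly_embed (q i 0).
exists (\col_i (a i + tofrac 'X_1 * b i)) => u x [y [z [py qz ->]]] i.
rewrite !mxE; apply: (@frac_valD _ _ (evx u)); first exact/aE/py.
apply: (@frac_valM _ _ (evx u)); last exact/bE/qz.
by have := frac_val_tofrac (evx u) 'X_1; rewrite /= mevalXU.
Qed.

Lemma ruled_param_fun (p q : 'cV[{fraction {poly R}}]_3) u x y :
  ruled_param p q u x -> ruled_param p q u y -> x = y.
Proof.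
by have [X XE] := ruled_ratmap p q; move=> /XE Xx /XE; apply: ratmap_fun.
Qed.

Lemma curve_val_open m (p : 'cV[{fraction {poly R}}]_m) t0 y0 :
  curve_val p t0 y0 -> exists d : {poly R}, d.[t0] != 0 /\
    forall t, d.[t] != 0 -> exists y, curve_val p t y.
Proof.
move=> /fin_all_exists[N /fin_all_exists[D pE]].
exists (\prod_i D i); split.
  by rewrite horner_prod; apply/prodf_neq0 => i _; have [] := pE i.
move=> t; rewrite horner_prod => /prodf_neq0 Dt.
exists (\col_i ((N i).[t] / (D i).[t])) => i; exists (N i), (D i).
by rewrite mxE; have [_ ? _] := pE i; split=> //; apply: Dt.
Qed.

(** [ruled_ratmap] goes only from [ruled_param] to [ratmap], so generic definedness of [p] and [q]
    is obtained separately, from their denominators. *)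
Lemma ruled_param_generic (p q : 'cV[{fraction {poly R}}]_3)
    (g : {mpoly R[3]}) u0 x0 : ruled_param p q u0 x0 -> peval g x0 != 0 ->
  generic_on setT (fun u => exists2 x, ruled_param p q u x & peval g x != 0).
Proof.
move=> Gx0 gx0; have [X XE] := ruled_ratmap p q.
have gX := ratmap_generic (XE _ _ Gx0) gx0.
have [a0 [b0 [/curve_val_open[dp [dp0 pE]] /curve_val_open[dq [dq0 qE]] _]]] := Gx0.
have [T TE] := poly_embed.
have gp : generic_on setT (fun u : 'cV[R]_2 => exists x, ruled_param p q u x).
  apply/generic_onP; exists (T dp * T dq), u0; split=> //.
    by rewrite pevalM !TE mulf_neq0.
  move=> u _; rewrite pevalM !TE mulf_eq0 negb_or => /andP[/pE[a pa] /qE[b qb]].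
  by exists (a + u 1 0 *: b), a, b.
apply: generic_onW (generic_onTI gp gX) => u [[x Gx] [y Xy gy]].
by exists x => //; rewrite (ratmap_fun (XE _ _ Gx) Xy).
Qed.

(** A polynomial that is nonzero at a point of the closure cannot vanish on the whole image of the
    parametrization. *)
Lemma ruled_surface_generic (p q : 'cV[{fraction {poly R}}]_3)
    (g : {mpoly R[3]}) x0 : ruled_surface p q x0 -> peval g x0 != 0 ->
  generic_on setT (fun u => exists2 x, ruled_param p q u x & peval g x != 0).
Proof.
move=> /zariski_closureP Sx0 gx0.
have /existsNP[x /not_implyP[[u Gx] gx]] :
    ~ forall y, (exists u, ruled_param p q u y) -> peval g y = 0.
  by move=> /Sx0 e; rewrite e eqxx in gx0.
by apply: (ruled_param_generic Gx); apply/eqP.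
Qed.

(** Let [h] be the pullback of an equation of [Y]. Were it nonzero at [x], it would be nonzero at
    generic parameters, some of which map into the closure of [Y]. *)
Lemma ruled_surface_affine_sub (p q : 'cV[{fraction {poly R}}]_3)
    (Y : set 'cV[R]_3) A b :
  generic_on setT (fun u => exists2 x, ruled_param p q u x &
                              zariski_closure Y (affine_map A b x)) ->
  forall x, ruled_surface p q x -> zariski_closure Y (affine_map A b x).
Proof.
move=> gen x Sx; apply/zariski_closureP => g gY.
have [h hE] := affine_pullback A b g.
rewrite -hE; apply/eqP/negPn/negP => hx.
have /generic_on_ex[u _ [[y Gy Yy] [z Gz hz]]] :=
  generic_onTI gen (ruled_surface_generic Sx hx).
move: hz; rewrite -(ruled_param_fun Gy Gz) hE.
by move/zariski_closureP: Yy => ->; rewrite ?eqxx.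
Qed.

(** * Lifting affine maps to the parameter planes *)

(* [phi] is psi o f o x; [e] is the product of the denominators of a
   representation of [psi] that is valid at [y0]. *)
Lemma ruled_lift (p q : 'cV[{fraction {poly R}}]_3)
    (psi : 'cV[{fraction {mpoly R[3]}}]_2) A b y0 v0 :
  ratmap psi y0 v0 ->
  exists (phi : 'cV[{fraction {mpoly R[2]}}]_2) (e : {mpoly R[3]}),
    peval e y0 != 0 /\
    forall u x v, ruled_param p q u x -> peval e (affine_map A b x) != 0 ->
      ratmap psi (affine_map A b x) v -> ratmap phi u v.
Proof.
move=> /fin_all_exists[N /fin_all_exists[D psiE]].
have [X XE] := ruled_ratmap p q.
have comp (g : {mpoly R[3]}) : exists F : {fraction {mpoly R[2]}},
    forall u x, ruled_param p q u x ->
      frac_val (evx u) F (peval g (affine_map A b x)).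
  have [h hE] := affine_pullback A b g; have [F FE] := ratmap_peval X h.
  by exists F => u x /XE /FE; rewrite hE.
have /fin_all_exists[F FE] := fun i => comp (N i).
have /fin_all_exists[G GE] := fun i => comp (D i).
exists (\col_i (F i / G i)), (\prod_i D i); split.
  by rewrite peval_prod; apply/prodf_neq0 => i _; have [] := psiE i.
move=> u x v Gx; rewrite peval_prod => /prodf_neq0 Dx psiv i.
set y := affine_map A b x in Dx psiv.
(* [psiv] may use another representation of [psi]; by uniqueness of values, the fixed one from which
   [phi] is built gives the same result. *)
have -> : v i 0 = peval (N i) y / peval (D i) y.
  apply: (@frac_val_fun _ _ (evx y) _ _ _ (psiv i)).
  by exists (N i), (D i); have [_ ? _] := psiE i; split=> //; apply: Dx.
rewrite mxE; apply: (@frac_valM _ _ (evx u)); first exact: FE.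
by apply: frac_valV; [exact: Dx|exact: GE].
Qed.

(** Puts properness in pointwise form; [y0] is a point where [psi] is defined, as [ruled_lift]
    requires. *)
Lemma proper_paramE (p q : 'cV[{fraction {poly R}}]_3) :
  proper_param p q ->
  exists (psi : 'cV[{fraction {mpoly R[3]}}]_2) g y0 v0,
  [/\ ruled_surface p q y0, peval g y0 != 0, ratmap psi y0 v0,
     generic_on setT (fun u => exists2 x, ruled_param p q u x & ratmap psi x u) &
     forall y, ruled_surface p q y -> peval g y != 0 ->
       exists2 v, ratmap psi y v & ruled_param p q v y].
Proof.
move=> [_ [psi [gid /generic_onP[g [y0 [Sy0 gy0 h]]]]]].
have {}h y : ruled_surface p q y -> peval g y != 0 ->
    exists2 v, ratmap psi y v & ruled_param p q v y.
  by move=> Sy gy; have [z [v psiv Gv] zE] := h y Sy gy; rewrite zE in Gv; exists v.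
have [v0 psiv0 _] := h y0 Sy0 gy0.
exists psi, g, y0, v0; split=> //.
by apply: generic_onW gid => u [w [x Gx psix] wE]; rewrite wE in psix; exists x.
Qed.

(** Abstracted over the affine map and its left inverse so that it serves for both composites of the
    two lifts. The points [x1] and [x2] witness that the nonvanishing conditions are generic on the
    first surface. *)
Lemma ruled_lift_inverse (p1 q1 p2 q2 : 'cV[{fraction {poly R}}]_3) A b A' b'
    (psi1 psi2 : 'cV[{fraction {mpoly R[3]}}]_2)
    (phi chi : 'cV[{fraction {mpoly R[2]}}]_2) (e1 e2 g2 : {mpoly R[3]}) x1 x2 :
  cancel (affine_map A b) (affine_map A' b') ->
  (forall x, ruled_surface p1 q1 x -> ruled_surface p2 q2 (affine_map A b x)) ->
  ruled_surface p1 q1 x1 -> peval e1 x1 != 0 ->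
  ruled_surface p1 q1 x2 -> peval g2 (affine_map A b x2) != 0 ->
  peval e2 (affine_map A b x2) != 0 ->
  generic_on setT
    (fun u => exists2 x, ruled_param p1 q1 u x & ratmap psi1 x u) ->
  (forall y, ruled_surface p2 q2 y -> peval g2 y != 0 ->
     exists2 v, ratmap psi2 y v & ruled_param p2 q2 v y) ->
  (forall u x v, ruled_param p1 q1 u x -> peval e2 (affine_map A b x) != 0 ->
     ratmap psi2 (affine_map A b x) v -> ratmap phi u v) ->
  (forall v y u, ruled_param p2 q2 v y -> peval e1 (affine_map A' b' y) != 0 ->
     ratmap psi1 (affine_map A' b' y) u -> ratmap chi v u) ->
  generic_on setT (fun u => exists x v, [/\ ruled_param p1 q1 u x,
    ruled_param p2 q2 v (affine_map A b x), ratmap phi u v & ratmap chi v u]).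
Proof.
move=> fK fS Sx1 e1x1 Sx2 g2x2 e2x2 gen1 inv2 phiE chiE.
have [g hg] := affine_pullback A b g2; have [e he] := affine_pullback A b e2.
rewrite -hg in g2x2; rewrite -he in e2x2.
have gen := generic_onTI gen1 (generic_onTI (ruled_surface_generic Sx1 e1x1)
  (generic_onTI (ruled_surface_generic Sx2 g2x2) (ruled_surface_generic Sx2 e2x2))).
apply: generic_onW gen => u.
move=> [[x Gx psi1x] [[y Gy e1x] [[z Gz g2x] [w Gw e2x]]]].
(* The parametrization is single-valued, so the four conditions concern the same point [x]. *)
move: e1x g2x e2x; rewrite -(ruled_param_fun Gx Gy) -(ruled_param_fun Gx Gz).
rewrite -(ruled_param_fun Gx Gw) hg he => e1x g2x e2x.
have Sx : ruled_surface p1 q1 x by apply/zariski_closureP => k; apply; exists u.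
have [v psi2v G2v] := inv2 _ (fS _ Sx) g2x.
exists x, v; split=> //; first exact: phiE Gx e2x psi2v.
by apply: chiE G2v _ _; rewrite fK.
Qed.

End Evaluation.

(** * Affine images and birational reparametrizations *)

Theorem theorem2 (R : realType) (p1 q1 p2 q2 : 'cV[{fraction {poly R}}]_3)
    (hx1 : proper_param p1 q1) (hx2 : proper_param p2 q2)
    (A : 'M[R]_3) (b : 'cV[R]_3) (hA : A \in unitmx) :
  affine_map A b @` ruled_surface p1 q1 = ruled_surface p2 q2 <->
  exists phi : 'cV[{fraction {mpoly R[2]}}]_2,
    birational_transformation phi /\
    generic_eq setT (part_comp (part_fun (affine_map A b)) (ruled_param p1 q1))
                    (part_comp (ruled_param p2 q2) (ratmap phi)).
Proof.
pose f := affine_map A b.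
pose f' := affine_map (invmx A) (- (invmx A *m b)).
have fK : cancel f f' by move=> x; rewrite /f /f' /affine_map mulmxDr mulKmx// addrK.
have f'K : cancel f' f.
  by move=> x; rewrite /f /f' /affine_map mulmxBr !mulKVmx// subrK.
have imS p q u x : ruled_param p q u x -> ruled_surface p q x.
  by move=> Gx; apply/zariski_closureP => g; apply; exists u.
split=> [fS|[phi [[_ [chi [chiphi phichi]]] fphi]]]; last first.
  have fS x : ruled_surface p1 q1 x -> ruled_surface p2 q2 (f x).
    apply: ruled_surface_affine_sub.
    apply: generic_onW fphi => u [y [x' Gx' ->] [v _ G2]].
    by exists x' => //; apply: imS G2.
  have f'S y : ruled_surface p2 q2 y -> ruled_surface p1 q1 (f' y).
    apply: ruled_surface_affine_sub.
    (* Where [h] is nonzero, both [chi o phi = id] and [f o x1 = x2 o phi] hold. Since [chi] sends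
       [v0] to [u0], where [h] is nonzero, it sends generic [v] into that locus. *)
    have /generic_onP[h [u0 [_ hu0 hE]]] := generic_onTI chiphi fphi.
    have [[w0 [v0 _ chiv0] w0E] _] := hE _ I hu0; rewrite w0E in chiv0.
    apply: generic_onW (generic_onTI phichi (ratmap_generic chiv0 hu0)).
    move=> v [[w [u' chiu' phiu'] wE] [u chiu hu]].
    rewrite wE in phiu'.
    have [_ [z [x Gx zE] [v' phiv' G2]]] := hE u I hu; rewrite zE in G2.
    (* With [u = chi(v)] and [phi(u) = v], the point [f x] is the value of the second
       parametrization at [v]. *)
    exists (f x); last by rewrite -/f' fK; apply: imS Gx.
    rewrite /= in phiu'; rewrite (ratmap_fun chiu' chiu) in phiu'.
    by rewrite (ratmap_fun phiu' phiv').
  apply/seteqP; split=> [_ [x Sx <-]|y Sy]; first exact: fS.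
  by exists (f' y); [exact: f'S|exact: f'K].
have fS1 x : ruled_surface p1 q1 x -> ruled_surface p2 q2 (f x).
  by move=> Sx; rewrite -fS; exists x.
have f'S2 y : ruled_surface p2 q2 y -> ruled_surface p1 q1 (f' y).
  by rewrite -fS => -[x Sx <-]; rewrite -/f fK.
have [psi1 [g1 [x1 [u1 [Sx1 g1x1 psi1x1 gen1 inv1]]]]] := proper_paramE hx1.
have [psi2 [g2 [y2 [v2 [Sy2 g2y2 psi2y2 gen2 inv2]]]]] := proper_paramE hx2.
have [phi [e2 [e2y2 phiE]]] := ruled_lift p1 q1 A b psi2y2.
have [chi [e1 [e1x1 chiE]]] :=
  ruled_lift p2 q2 (invmx A) (- (invmx A *m b)) psi1x1.
have chiphi : generic_on setT (fun u => exists x v, [/\ ruled_param p1 q1 u x,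
    ruled_param p2 q2 v (f x), ratmap phi u v & ratmap chi v u]).
  (* The witness [f' y2] is mapped by [f] to [y2], where [g2] and [e2] are nonzero. *)
  by apply: (ruled_lift_inverse (x2 := f' y2) fK fS1 Sx1 e1x1 _ _ _ gen1 inv2 phiE chiE);
    rewrite -/f ?f'K//; apply: f'S2.
have phichi : generic_on setT (fun v => exists y u, [/\ ruled_param p2 q2 v y,
    ruled_param p1 q1 u (f' y), ratmap chi v u & ratmap phi u v]).
  (* Same argument with the two surfaces exchanged and [f'] in place of [f]. *)
  by apply: (ruled_lift_inverse (x2 := f x1) f'K f'S2 Sy2 e2y2 _ _ _ gen2 inv1 chiE phiE);
    rewrite -/f' ?fK//; apply: fS1.
exists phi; split; last first.
  apply: generic_onW chiphi => u [x [v [Gx G2 phiu _]]].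
  by exists (f x); [exists x|exists v].
split=> //; exists chi; split.
  by apply: generic_onW chiphi => u [_ [v [_ _ phiu chiv]]]; exists u => //; exists v.
by apply: generic_onW phichi => v [_ [u [_ _ chiv phiu]]]; exists v => //; exists u.
Qed.
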